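(* Let $L$ be a link and $S$ a Wirtinger generating set for its link group $G(L)$. Then $$\operatorname{Env}(\mathcal{D}(S^{G(L)}))\cong G(L).$$
   Context: Let $L$ be an oriented link in $\mathbb{S}^3$ with an oriented diagram. The link group is $G(L)=\pi_1(\mathbb{S}^3\setminus L)$. Its Wirtinger presentation has one generator for each arc of the diagram (these form a Wirtinger generating set $S$) and one relation for each crossing: if $y$ is the over-arc, $x$ the incoming under-arc and $z$ the outgoing under-arc, then $z=yxy^{-1}$ at a positive crossing and $z=y^{-1}xy$ at a negative crossing. A quandle is a non-empty set $Q$ with a binary operation $*$ such that: (i) $x*x=x$ for all $x$; (ii) for all $x,y\in Q$ there is a unique $z\in Q$ with $x=z*y$; (iii) $(x*y)*z=(x*z)*(y*z)$ for all $x,y,z$. For a group $G$ and a non-empty subset $A\subseteq G$, let $A^G$ be the set of all conjugates in $G$ of elements of $A$. The Dehn quandle $\mathcal{D}(A^G)$ is the set $A^G$ with the operation $x*y=yxy^{-1}$. The enveloping group $\operatorname{Env}(Q)$ of a quandle $Q$ is the group with generators $\{e_x\mid x\in Q\}$ and defining relations $e_{x*y}=e_ye_xe_y^{-1}$ for all $x,y\in Q$. *)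

(* Defs.v *)
From HB Require Import structures.
From mathcomp Require Import all_boot all_order all_algebra.
From mathcomp Require Import all_classical all_reals all_analysis.
From mathcomp Require Import wedge_sigT continuous_path.
From mathcomp Require Import ring lra zify.

Set Implicit Arguments.
Unset Strict Implicit.
Unset Printing Implicit Defensive.

Import Order.TTheory GRing.Theory Num.Theory.
Import numFieldNormedType.Exports.

Local Open Scope classical_set_scope.
Local Open Scope ring_scope.
Local Open Scope quotient_scope.

Inductive gterm (X : Type) : Type :=
| GVar of X
| GOne
| GMul of gterm X & gterm X
| GInv of gterm X.

Arguments GOne {X}.

HB.instance Definition _ (X : Type) := gen_eqMixin (gterm X).
HB.instance Definition _ (X : Type) := gen_choiceMixin (gterm X).

Section presentation.
Context (X : Type) (rel : gterm X -> gterm X -> Prop).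

(* The least congruence that contains the group laws and [rel]. *)
Inductive gterm_eq : gterm X -> gterm X -> Prop :=
| gterm_rel a b : rel a b -> gterm_eq a b
| gterm_refl a : gterm_eq a a
| gterm_sym a b : gterm_eq a b -> gterm_eq b a
| gterm_trans b a c : gterm_eq a b -> gterm_eq b c -> gterm_eq a c
| gterm_mul a a' b b' :
    gterm_eq a a' -> gterm_eq b b' -> gterm_eq (GMul a b) (GMul a' b')
| gterm_inv a a' : gterm_eq a a' -> gterm_eq (GInv a) (GInv a')
| gterm_mulA a b c : gterm_eq (GMul a (GMul b c)) (GMul (GMul a b) c)
| gterm_1mul a : gterm_eq (GMul GOne a) a
| gterm_mul1 a : gterm_eq (GMul a GOne) a
| gterm_Vmul a : gterm_eq (GMul (GInv a) a) GOne
| gterm_mulV a : gterm_eq (GMul a (GInv a)) GOne.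

Definition gterm_eqb (a b : gterm X) : bool := `[< gterm_eq a b >].

Lemma gterm_eqb_refl : reflexive gterm_eqb.
Proof. by move=> a; apply/asboolP/gterm_refl. Qed.

Lemma gterm_eqb_sym : symmetric gterm_eqb.
Proof. by move=> a b; apply/asboolP/asboolP; exact: gterm_sym. Qed.

Lemma gterm_eqb_trans : transitive gterm_eqb.
Proof.
move=> b a c /asboolP ab /asboolP bc; apply/asboolP; exact: gterm_trans ab bc.
Qed.

Canonical gterm_equiv :=
  EquivRel gterm_eqb gterm_eqb_refl gterm_eqb_sym gterm_eqb_trans.

Definition presented_group : Type := {eq_quot gterm_equiv}.

HB.instance Definition _ := Choice.on presented_group.
HB.instance Definition _ := EqQuotient.on presented_group.

Definition gclass (a : gterm X) : presented_group := \pi_presented_group a.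

Lemma gclassP (a b : gterm X) : gclass a = gclass b <-> gterm_eq a b.
Proof.
by split=> [/eqmodP/asboolP//|ab]; apply/eqmodP/asboolP.
Qed.

Lemma gclass_repr (u : presented_group) : gclass (repr u) = u.
Proof. exact: reprK. Qed.

Lemma repr_gclass (a : gterm X) : gterm_eq (repr (gclass a)) a.
Proof. by apply/gclassP; rewrite gclass_repr. Qed.

Definition presented_one : presented_group := gclass GOne.
Definition presented_mul (u v : presented_group) : presented_group :=
  gclass (GMul (repr u) (repr v)).
Definition presented_inv (u : presented_group) : presented_group :=
  gclass (GInv (repr u)).

Lemma presented_mulE (a b : gterm X) :
  presented_mul (gclass a) (gclass b) = gclass (GMul a b).
Proof. by apply/gclassP/gterm_mul; exact: repr_gclass. Qed.

Lemma presented_invE (a : gterm X) :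
  presented_inv (gclass a) = gclass (GInv a).
Proof. by apply/gclassP/gterm_inv; exact: repr_gclass. Qed.

Lemma presented_mulA : associative presented_mul.
Proof.
move=> u v w; rewrite -(gclass_repr u) -(gclass_repr v) -(gclass_repr w).
by rewrite !presented_mulE; apply/gclassP/gterm_mulA.
Qed.

Lemma presented_mul1g : left_id presented_one presented_mul.
Proof.
move=> u; rewrite -(gclass_repr u) presented_mulE.
by apply/gclassP/gterm_1mul.
Qed.

Lemma presented_mulg1 : right_id presented_one presented_mul.
Proof.
move=> u; rewrite -(gclass_repr u) presented_mulE.
by apply/gclassP/gterm_mul1.
Qed.

Lemma presented_mulVg :
  left_inverse presented_one presented_inv presented_mul.
Proof.
move=> u; rewrite -(gclass_repr u) presented_invE presented_mulE.
by apply/gclassP/gterm_Vmul.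
Qed.

Lemma presented_mulgV :
  right_inverse presented_one presented_inv presented_mul.
Proof.
move=> u; rewrite -(gclass_repr u) presented_invE presented_mulE.
by apply/gclassP/gterm_mulV.
Qed.

HB.instance Definition _ := isGroup.Build presented_group presented_mulA
  presented_mul1g presented_mulg1 presented_mulVg presented_mulgV.

Definition gen (x : X) : presented_group := gclass (GVar x).

(* [w] exhibits [G] as the group with generators [X] and relations [rel]. *)
Definition is_presentation (G : groupType) (w : X -> G) : Prop :=
  exists2 f : {multiplicative presented_group -> G},
    bijective f & forall x, f (gen x) = w x.

End presentation.

Definition isomorphic (G H : groupType) : Prop :=
  exists f : {multiplicative G -> H}, bijective f.

Record quandle : Type := Quandle {
  quandle_carrier :> Type;
  qop : quandle_carrier -> quandle_carrier -> quandle_carrier;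
  quandle_inhabited : inhabited quandle_carrier;
  qop_idem : forall x, qop x x = x;
  qop_div : forall x y, exists! z, x = qop z y;
  qop_dist : forall x y z, qop (qop x y) z = qop (qop x z) (qop y z)
}.

Section enveloping_group.
Context (Q : quandle).

Definition env_rel (a b : gterm Q) : Prop :=
  exists x y : Q,
    a = GVar (qop x y) /\
    b = GMul (GMul (GVar y) (GVar x)) (GInv (GVar y)).

Definition Env : groupType := presented_group env_rel.

End enveloping_group.

Section dehn_quandle.
Local Open Scope group_scope.
Context (G : groupType) (A : set G).

Definition conjugates : set G := [set a ^ g | a in A & g in [set: G]].

Definition dehn_carrier : Type := set_type conjugates.

Lemma conjugates_dehn (x y : G) :
  conjugates x -> conjugates (y * x * y^-1).
Proof.
move=> [a Aa [g _ <-]]; exists a => //; exists (g * y^-1) => //.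
by rewrite conjgM /conjg invgK mulgA.
Qed.

Definition dehn_op (x y : dehn_carrier) : dehn_carrier :=
  SigSub (mem_set (conjugates_dehn (val y) (set_mem (valP x)))).

Lemma val_dehn_op (x y : dehn_carrier) :
  val (dehn_op x y) = val y * val x * (val y)^-1.
Proof. by []. Qed.

Lemma dehn_inhabited : A !=set0 -> inhabited dehn_carrier.
Proof.
move=> [a Aa]; constructor; exists a; apply/mem_set.
by exists a => //; exists 1 => //; rewrite conjg1.
Qed.

Lemma dehn_idem x : dehn_op x x = x.
Proof. by apply: val_inj; rewrite val_dehn_op mulgK. Qed.

Lemma dehn_div x y : exists! z, x = dehn_op z y.
Proof.
have H : conjugates ((val y)^-1 * val x * (val y)^-1^-1).
  exact: conjugates_dehn (set_mem (valP x)).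
exists (SigSub (mem_set H)); split => [|z xE].
  by apply: val_inj; rewrite val_dehn_op /= invgK !mulgA mulgV mul1g mulgK.
apply: val_inj; rewrite /= xE val_dehn_op invgK.
by rewrite !mulgA mulVg mul1g -mulgA mulVg mulg1.
Qed.

Lemma dehn_dist x y z :
  dehn_op (dehn_op x y) z = dehn_op (dehn_op x z) (dehn_op y z).
Proof.
apply: val_inj; rewrite !val_dehn_op !invgM invgK !mulgA.
by rewrite !mulgVK.
Qed.

Definition dehn_quandle (A0 : A !=set0) : quandle :=
  Quandle (dehn_inhabited A0) dehn_idem dehn_div dehn_dist.

End dehn_quandle.

Definition unit_interval (R : realType) : Type :=
  set_type (`[0, 1]%classic : set R).

HB.instance Definition _ (R : realType) := Topological.on (unit_interval R).

Section unit_interval.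
Context (R : realType).
Local Notation I := (unit_interval R).
Implicit Types (s t : I) (r : R).

Definition ival s : R := val s.

Lemma clamp_in r : Num.max 0 (Num.min 1 r) \in (`[0, 1]%classic : set R).
Proof.
by apply/mem_set; rewrite /= in_itv /= le_max lexx ge_max ler01 ge_min lexx.
Qed.

Definition clamp r : I := SigSub (clamp_in r).

Lemma ival_I01 s : 0 <= ival s <= 1.
Proof. rewrite /ival. by have := set_mem (valP s); rewrite /= in_itv. Qed.

Lemma clampK r : 0 <= r <= 1 -> ival (clamp r) = r.
Proof. by move=> /andP[r0 r1]; rewrite /ival /= (min_idPr r1) (max_idPr r0). Qed.

Lemma clamp_ival s : clamp (ival s) = s.
Proof. by apply: val_inj; rewrite -/(ival _) clampK// ival_I01. Qed.

Lemma clamp0_neq1 : clamp 0 != clamp 1.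
Proof.
apply/eqP => /(congr1 ival); rewrite !clampK ?lexx ?ler01//.
by move/eqP; rewrite eq_sym oner_eq0.
Qed.

HB.instance Definition _ := isBiPointed.Build I clamp0_neq1.

Lemma ival_zero : ival (zero : I) = 0.
Proof. by rewrite clampK// lexx ler01. Qed.

Lemma ival_one : ival (one : I) = 1.
Proof. by rewrite clampK// lexx ler01. Qed.

Lemma ival_continuous : continuous ival.
Proof. exact: initial_continuous. Qed.

Lemma clamp_continuous : continuous clamp.
Proof.
apply: continuous_comp_initial => r.
apply: (@continuous_max R _ (fun=> 0)); first exact: cvg_cst.
by apply: (@continuous_min R _ (fun=> 1)); [exact: cvg_cst|exact: cvg_id].
Qed.

End unit_interval.

Arguments clamp : simpl never.
Arguments ival {R} s : simpl never.

Section continuous_lemmas.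
Context {X Y Z : topologicalType}.

Lemma comp_continuous (f : X -> Y) (g : Y -> Z) :
  continuous f -> continuous g -> continuous (fun x => g (f x)).
Proof. by move=> cf cg x; apply: continuous_comp; [exact: cf|exact: cg]. Qed.

Lemma fst_continuous : continuous (fun xy : X * Y => xy.1).
Proof. by move=> [x y]; exact: cvg_fst. Qed.

Lemma snd_continuous : continuous (fun xy : X * Y => xy.2).
Proof. by move=> [x y]; exact: cvg_snd. Qed.

Lemma pair_continuous (f : X -> Y) (g : X -> Z) :
  continuous f -> continuous g -> continuous (fun x => (f x, g x)).
Proof. by move=> cf cg x; apply: cvg_pair; [exact: cf|exact: cg]. Qed.

End continuous_lemmas.

Section real_continuous_lemmas.
Context {R : realType} {X : topologicalType}.
Implicit Types f g : X -> R.

Lemma add_continuous_fun f g :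
  continuous f -> continuous g -> continuous (fun x => f x + g x).
Proof. by move=> cf cg x; apply: cvgD; [exact: cf|exact: cg]. Qed.

Lemma sub_continuous_fun f g :
  continuous f -> continuous g -> continuous (fun x => f x - g x).
Proof. by move=> cf cg x; apply: cvgB; [exact: cf|exact: cg]. Qed.

Lemma mul_continuous_fun f g :
  continuous f -> continuous g -> continuous (fun x => f x * g x).
Proof. by move=> cf cg x; apply: cvgM; [exact: cf|exact: cg]. Qed.

End real_continuous_lemmas.

Lemma paste_continuous (R : realType) (X T : topologicalType)
    (a : X -> R) (f g : X -> T) :
  continuous a -> continuous f -> continuous g ->
  (forall x, a x = 0 -> f x = g x) ->
  continuous (fun x => if a x <= 0 then f x else g x).
Proof.
move=> ca cf cg fg; apply/continuous_subspace_setT.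
have -> : [set: X] = (a @^-1` [set r | r <= 0]) `|` (a @^-1` [set r | 0 <= r]).
  by apply/seteqP; split=> x _ //=; apply/orP/le_total.
apply: withinU_continuous.
- by apply: preimage_closed => [x _|]; [exact: ca|exact: closed_le].
- by apply: preimage_closed => [x _|]; [exact: ca|exact: closed_ge].
- apply: (@subspace_eq_continuous _ _ _ f); last first.
    exact: continuous_subspaceT.
  by move=> x /set_mem /= ax; rewrite /from_subspace ax.
- apply: (@subspace_eq_continuous _ _ _ g); last first.
    exact: continuous_subspaceT.
  move=> x /set_mem /= ax; rewrite /from_subspace; case: ifPn => // ax'.
  by rewrite fg//; apply/eqP; rewrite eq_le ax' ax.
Qed.

Section fundamental_group.
Context (R : realType) (T : topologicalType) (x0 : T).
Local Notation I := (unit_interval R).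
Local Notation loop := {path I from x0 to x0 in T}.

Definition loop_homotopic (p q : loop) : Prop :=
  exists H : I * I -> T,
    [/\ continuous H,
        forall s, H (s, zero) = p s,
        forall s, H (s, one) = q s &
        forall t, H (zero, t) = x0 /\ H (one, t) = x0].

Lemma sub21 : 2 - 1 = 1 :> R.
Proof. by lra. Qed.

Lemma loop_continuous (p : loop) : continuous p.
Proof. exact: cts_fun. Qed.

Lemma comp_clamp_continuous (X : topologicalType) (p : I -> T) (a : X -> R) :
  continuous p -> continuous a -> continuous (fun x => p (clamp (a x))).
Proof.
move=> cp ca; apply: comp_continuous cp.
exact: comp_continuous ca (@clamp_continuous R).
Qed.

(* Straight-line homotopy between two parametrizations of the same map. *)
Lemma reparam_homotopic (f : I -> T) (p q : loop) (a b : I -> R) :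
  continuous f -> continuous a -> continuous b ->
  a zero = b zero -> a one = b one ->
  (forall s, p s = f (clamp (a s))) -> (forall s, q s = f (clamp (b s))) ->
  loop_homotopic p q.
Proof.
move=> cf ca cb ab0 ab1 pE qE.
exists (fun st => f (clamp ((1 - ival st.2) * a st.1 + ival st.2 * b st.1))).
split=> [|s|s|t] /=.
- apply: comp_clamp_continuous => //.
  have cval : continuous (fun st : I * I => ival st.2).
    exact: comp_continuous snd_continuous (@ival_continuous R).
  apply: add_continuous_fun; apply: mul_continuous_fun => //.
  - by apply: sub_continuous_fun => //; exact: cst_continuous.
  - exact: comp_continuous fst_continuous ca.
  - exact: comp_continuous fst_continuous cb.
- by rewrite pE ival_zero subr0 mul1r mul0r addr0.
- by rewrite qE ival_one subrr mul1r mul0r add0r.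
- rewrite -ab0 -ab1 -!mulrDl subrK !mul1r -!pE; split.
    exact: path_zero.
  exact: path_one.
Qed.

Lemma loop_homotopic_refl p : loop_homotopic p p.
Proof.
apply: (@reparam_homotopic p p p ival ival) => //; try exact: ival_continuous.
- exact: loop_continuous.
- by move=> s; rewrite clamp_ival.
- by move=> s; rewrite clamp_ival.
Qed.

Lemma loop_homotopic_sym p q : loop_homotopic p q -> loop_homotopic q p.
Proof.
move=> [H [cH H0 H1 Hx]].
exists (fun st => H (st.1, clamp (1 - ival st.2))).
split=> [|s|s|t] /=.
- apply: comp_continuous cH.
  apply: pair_continuous; first exact: fst_continuous.
  apply: (comp_continuous _ (@clamp_continuous R)).
  apply: sub_continuous_fun; first exact: cst_continuous.
  exact: comp_continuous snd_continuous (@ival_continuous R).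
- by rewrite ival_zero subr0 H1.
- by rewrite ival_one subrr H0.
- exact: Hx.
Qed.

Lemma loop_homotopic_trans q p r :
  loop_homotopic p q -> loop_homotopic q r -> loop_homotopic p r.
Proof.
move=> [H [cH H0 H1 Hx]] [K [cK K0 K1 Kx]].
have cval2 : continuous (fun st : I * I => ival st.2).
  exact: comp_continuous snd_continuous (@ival_continuous R).
have cH' (L : I * I -> T) (a : I * I -> R) : continuous L -> continuous a ->
    continuous (fun st => L (st.1, clamp (a st))).
  move=> cL ca; apply: comp_continuous cL.
  apply: pair_continuous; first exact: fst_continuous.
  exact: comp_continuous ca (@clamp_continuous R).
exists (fun st => if ival st.2 - 2^-1 <= 0
  then H (st.1, clamp (2 * ival st.2)) else K (st.1, clamp (2 * ival st.2 - 1))).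
have c2 : continuous (fun st : I * I => 2 * ival st.2 : R).
  by apply: mul_continuous_fun => //; exact: cst_continuous.
split=> [|s|s|t] /=.
- apply: paste_continuous.
  + by apply: sub_continuous_fun => //; exact: cst_continuous.
  + exact: cH'.
  + by apply: cH' => //; apply: sub_continuous_fun => //; exact: cst_continuous.
  + move=> [s t] /= /eqP; rewrite subr_eq0 => /eqP ->.
    by rewrite mulfV// subrr H1 K0.
- by rewrite ival_zero mulr0 ifT; [exact: H0|lra].
- rewrite ival_one mulr1 sub21 ifF; first exact: K1.
  by apply/negbTE; rewrite -ltNge; lra.
- by case: ifP => _; [exact: Hx|exact: Kx].
Qed.

Definition loop_homotopicb (p q : loop) : bool := `[< loop_homotopic p q >].

Lemma loop_homotopicb_refl : reflexive loop_homotopicb.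
Proof. by move=> p; apply/asboolP/loop_homotopic_refl. Qed.

Lemma loop_homotopicb_sym : symmetric loop_homotopicb.
Proof. by move=> p q; apply/asboolP/asboolP; exact: loop_homotopic_sym. Qed.

Lemma loop_homotopicb_trans : transitive loop_homotopicb.
Proof.
move=> q p r /asboolP pq /asboolP qr; apply/asboolP.
exact: loop_homotopic_trans pq qr.
Qed.

Canonical loop_equiv := EquivRel loop_homotopicb
  loop_homotopicb_refl loop_homotopicb_sym loop_homotopicb_trans.

Definition fundamental_group : Type := {eq_quot loop_equiv}.

HB.instance Definition _ := Choice.on fundamental_group.
HB.instance Definition _ := EqQuotient.on fundamental_group.

Definition loop_class (p : loop) : fundamental_group :=
  \pi_fundamental_group p.

Lemma loop_classP p q : loop_class p = loop_class q <-> loop_homotopic p q.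
Proof. by split=> [/eqmodP/asboolP//|pq]; apply/eqmodP/asboolP. Qed.

Lemma loop_class_repr (u : fundamental_group) : loop_class (repr u) = u.
Proof. exact: reprK. Qed.

Lemma repr_loop_class p : loop_homotopic (repr (loop_class p)) p.
Proof. by apply/loop_classP; rewrite loop_class_repr. Qed.

Lemma ival_affine_continuous (c d : R) : continuous (fun s : I => c * ival s + d).
Proof.
apply: add_continuous_fun; last exact: cst_continuous.
by apply: mul_continuous_fun; [exact: cst_continuous|exact: ival_continuous].
Qed.

Definition cat_fun (p q : I -> T) (s : I) : T :=
  if ival s <= 2^-1 then p (clamp (2 * ival s)) else q (clamp (2 * ival s - 1)).

Lemma cat_continuous (p q : loop) : continuous (cat_fun p q).
Proof.
have -> : cat_fun p q = fun s : I => if ival s - 2^-1 <= 0 then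
    p (clamp (2 * ival s + 0)) else q (clamp (2 * ival s + - 1)).
  by apply/funext => s; rewrite /cat_fun subr_le0 addr0.
apply: paste_continuous.
- apply: sub_continuous_fun; last exact: cst_continuous.
  exact: ival_continuous.
- by apply: comp_clamp_continuous;
    [exact: loop_continuous|exact: ival_affine_continuous].
- by apply: comp_clamp_continuous;
    [exact: loop_continuous|exact: ival_affine_continuous].
- move=> s /eqP; rewrite subr_eq0 => /eqP ->.
  by rewrite mulfV// addr0 subrr; rewrite [LHS]path_one [RHS]path_zero.
Qed.

Lemma cat_zero (p q : loop) : cat_fun p q zero = x0.
Proof. by rewrite /cat_fun ival_zero invr_ge0 ler0n mulr0 [LHS]path_zero. Qed.

Lemma cat_one (p q : loop) : cat_fun p q one = x0.
Proof.
rewrite /cat_fun ival_one ifF; last by apply/negbTE; rewrite -ltNge; lra.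
by rewrite mulr1 sub21 [LHS]path_one.
Qed.

Definition loop_cat (p q : loop) : loop :=
  mk_path (@cat_continuous p q) (cat_zero p q) (cat_one p q).

Definition loop_rev_fun (p : I -> T) (s : I) : T := p (clamp (1 - ival s)).

Lemma rev_continuous (p : loop) : continuous (loop_rev_fun p).
Proof.
have -> : loop_rev_fun p = fun s => p (clamp (- 1 * ival s + 1)).
  by apply/funext => s; rewrite /loop_rev_fun mulN1r addrC.
by apply: comp_clamp_continuous;
  [exact: loop_continuous|exact: ival_affine_continuous].
Qed.

Lemma rev_zero (p : loop) : loop_rev_fun p zero = x0.
Proof. by rewrite /loop_rev_fun ival_zero subr0 [LHS]path_one. Qed.

Lemma rev_one (p : loop) : loop_rev_fun p one = x0.
Proof. by rewrite /loop_rev_fun ival_one subrr [LHS]path_zero. Qed.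

Definition loop_rev (p : loop) : loop :=
  mk_path (@rev_continuous p) (rev_zero p) (rev_one p).

Lemma loop_catE (p q : loop) s : loop_cat p q s =
  if ival s <= 2^-1 then p (clamp (2 * ival s)) else q (clamp (2 * ival s - 1)).
Proof. by []. Qed.

Lemma loop_revE (p : loop) s : loop_rev p s = p (clamp (1 - ival s)).
Proof. by []. Qed.

Definition loop_cst : loop := cst x0.

Lemma loop_cat_homotopic p p' q q' :
  loop_homotopic p p' -> loop_homotopic q q' ->
  loop_homotopic (loop_cat p q) (loop_cat p' q').
Proof.
move=> [H [cH H0 H1 Hx]] [K [cK K0 K1 Kx]].
exists (fun st => if ival st.1 - 2^-1 <= 0 then H (clamp (2 * ival st.1), st.2)
  else K (clamp (2 * ival st.1 - 1), st.2)).
have cval1 : continuous (fun st : I * I => ival st.1).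
  exact: comp_continuous fst_continuous (@ival_continuous R).
have cH' (L : I * I -> T) (a : I * I -> R) : continuous L -> continuous a ->
    continuous (fun st => L (clamp (a st), st.2)).
  move=> cL ca; apply: comp_continuous cL.
  apply: pair_continuous; last exact: snd_continuous.
  exact: comp_continuous ca (@clamp_continuous R).
have c2 : continuous (fun st : I * I => 2 * ival st.1 : R).
  by apply: mul_continuous_fun => //; exact: cst_continuous.
split=> [|s|s|t] /=.
- apply: paste_continuous.
  + by apply: sub_continuous_fun => //; exact: cst_continuous.
  + exact: cH'.
  + by apply: cH' => //; apply: sub_continuous_fun => //; exact: cst_continuous.
  + move=> [s t] /= /eqP; rewrite subr_eq0 => /eqP ->; rewrite mulfV// subrr.
    by have [_ ->] := Hx t; have [-> _] := Kx t.
- by rewrite subr_le0 H0 K0.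
- by rewrite subr_le0 H1 K1.
- split.
    rewrite ival_zero mulr0 ifT; last by rewrite sub0r oppr_le0 invr_ge0.
    by have [+ _] := Hx t.
  rewrite ival_one mulr1 sub21 ifF; last first.
    by apply/negbTE; rewrite -ltNge; lra.
  by have [_ +] := Kx t.
Qed.

Lemma loop_rev_homotopic p p' :
  loop_homotopic p p' -> loop_homotopic (loop_rev p) (loop_rev p').
Proof.
move=> [H [cH H0 H1 Hx]].
exists (fun st => H (clamp (1 - ival st.1), st.2)); split=> [|s|s|t] /=.
- apply: comp_continuous cH.
  apply: pair_continuous; last exact: snd_continuous.
  apply: (comp_continuous _ (@clamp_continuous R)).
  apply: sub_continuous_fun; first exact: cst_continuous.
  exact: comp_continuous fst_continuous (@ival_continuous R).
- exact: H0.
- exact: H1.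
- by rewrite ival_zero ival_one subr0 subrr; have [? ?] := Hx t.
Qed.

Lemma min_continuous (a b : I -> R) : continuous a -> continuous b ->
  continuous (fun s => Num.min (a s) (b s)).
Proof. by move=> ca cb s; apply: continuous_min; [exact: ca|exact: cb]. Qed.

Lemma max_continuous (a b : I -> R) : continuous a -> continuous b ->
  continuous (fun s => Num.max (a s) (b s)).
Proof. by move=> ca cb s; apply: continuous_max; [exact: ca|exact: cb]. Qed.

Lemma loop_catA p q r :
  loop_homotopic (loop_cat p (loop_cat q r)) (loop_cat (loop_cat p q) r).
Proof.
apply: (@reparam_homotopic (loop_cat p (loop_cat q r)) _ _ ival (fun s =>
  Num.min (2 * ival s + 0) (Num.min (1 * ival s + 4^-1) (2^-1 * ival s + 2^-1)))).
- exact: loop_continuous.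
- exact: ival_continuous.
- by do 2?[apply: min_continuous]; exact: ival_affine_continuous.
- by rewrite ival_zero /Num.min; do !case: ifPn; lra.
- by rewrite ival_one /Num.min; do !case: ifPn; lra.
- by move=> s; rewrite clamp_ival.
move=> s; have /andP[s0 s1] := ival_I01 s.
rewrite !loop_catE.
set u := Num.min _ _.
have [s2|s2] := leP (ival s) 2^-1; last first.
  have uE : u = 2^-1 * ival s + 2^-1.
    by rewrite /u /Num.min; do !case: ifPn; rewrite -?leNgt; lra.
  rewrite uE clampK; last lra.
  rewrite ifF; last by apply/negbTE; rewrite -ltNge; lra.
  rewrite clampK; last lra.
  rewrite ifF; last by apply/negbTE; rewrite -ltNge; lra.
  by congr (r (clamp _)); lra.
rewrite clampK; last lra.
have [s4|s4] := leP (2 * ival s) 2^-1; last first.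
  have uE : u = ival s + 4^-1.
    by rewrite /u /Num.min; do !case: ifPn; rewrite -?leNgt; lra.
  rewrite uE clampK; last lra.
  rewrite ifF; last by apply/negbTE; rewrite -ltNge; lra.
  rewrite clampK; last lra.
  rewrite ifT; last lra.
  by congr (q (clamp _)); lra.
have uE : u = 2 * ival s.
  by rewrite /u /Num.min; do !case: ifPn; rewrite -?leNgt; lra.
rewrite uE clampK; last lra.
by rewrite s4.
Qed.

Lemma loop_cst_cat p : loop_homotopic (loop_cat loop_cst p) p.
Proof.
apply: loop_homotopic_sym.
apply: (@reparam_homotopic p _ _ ival
  (fun s => Num.max 0 (2 * ival s + - 1))).
- exact: loop_continuous.
- exact: ival_continuous.
- apply: max_continuous; first exact: cst_continuous.
  exact: ival_affine_continuous.
- by rewrite ival_zero /Num.max; case: ifPn; lra.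
- by rewrite ival_one /Num.max; case: ifPn; lra.
- by move=> s; rewrite clamp_ival.
move=> s; rewrite !loop_catE; case: ifPn => [s2|s2].
  rewrite max_l; last lra.
  by rewrite [RHS]path_zero.
by rewrite max_r//; move: s2; rewrite -ltNge; lra.
Qed.

Lemma loop_cat_cst p : loop_homotopic (loop_cat p loop_cst) p.
Proof.
apply: loop_homotopic_sym.
apply: (@reparam_homotopic p _ _ ival (fun s => Num.min 1 (2 * ival s + 0))).
- exact: loop_continuous.
- exact: ival_continuous.
- apply: min_continuous; first exact: cst_continuous.
  exact: ival_affine_continuous.
- by rewrite ival_zero /Num.min; case: ifPn; lra.
- by rewrite ival_one /Num.min; case: ifPn; lra.
- by move=> s; rewrite clamp_ival.
move=> s; rewrite !loop_catE addr0; case: ifPn => [s2|s2].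
  by rewrite min_r//; lra.
rewrite min_l; last by move: s2; rewrite -ltNge; lra.
by rewrite [RHS]path_one.
Qed.

Lemma loop_cat_rev p : loop_homotopic (loop_cat p (loop_rev p)) loop_cst.
Proof.
apply: (@reparam_homotopic p _ _
  (fun s => Num.min (2 * ival s + 0) (- 2 * ival s + 2)) (fun=> 0)).
- exact: loop_continuous.
- by apply: min_continuous; exact: ival_affine_continuous.
- exact: cst_continuous.
- by rewrite ival_zero /Num.min; case: ifPn; lra.
- by rewrite ival_one /Num.min; case: ifPn; lra.
- move=> s; have /andP[s0 s1] := ival_I01 s; rewrite !loop_catE.
  case: ifPn => [s2|]; first by rewrite min_l ?addr0//; lra.
  rewrite -ltNge => s2; rewrite min_r; last lra.
  rewrite loop_revE clampK; last lra.
  by congr (p (clamp _)); lra.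
- by move=> s; rewrite [RHS]path_zero.
Qed.

Lemma loop_revK p : loop_homotopic (loop_rev (loop_rev p)) p.
Proof.
apply: (@reparam_homotopic p _ _ ival ival) => //.
- exact: loop_continuous.
- exact: ival_continuous.
- exact: ival_continuous.
- move=> s; have /andP[s0 s1] := ival_I01 s.
  rewrite !loop_revE clampK; last lra.
  by rewrite subKr.
- by move=> s; rewrite clamp_ival.
Qed.

Lemma loop_rev_cat p : loop_homotopic (loop_cat (loop_rev p) p) loop_cst.
Proof.
apply: loop_homotopic_trans (loop_cat_rev (loop_rev p)).
apply: loop_cat_homotopic; first exact: loop_homotopic_refl.
exact/loop_homotopic_sym/loop_revK.
Qed.

Definition pi1_one : fundamental_group := loop_class loop_cst.
Definition pi1_mul (u v : fundamental_group) : fundamental_group :=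
  loop_class (loop_cat (repr u) (repr v)).
Definition pi1_inv (u : fundamental_group) : fundamental_group :=
  loop_class (loop_rev (repr u)).

Lemma pi1_mulE p q :
  pi1_mul (loop_class p) (loop_class q) = loop_class (loop_cat p q).
Proof. by apply/loop_classP/loop_cat_homotopic; exact: repr_loop_class. Qed.

Lemma pi1_invE p : pi1_inv (loop_class p) = loop_class (loop_rev p).
Proof. by apply/loop_classP/loop_rev_homotopic; exact: repr_loop_class. Qed.

Lemma pi1_mulA : associative pi1_mul.
Proof.
move=> u v w.
rewrite -(loop_class_repr u) -(loop_class_repr v) -(loop_class_repr w).
by rewrite !pi1_mulE; apply/loop_classP/loop_catA.
Qed.

Lemma pi1_mul1g : left_id pi1_one pi1_mul.
Proof.
move=> u; rewrite -(loop_class_repr u) pi1_mulE.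
exact/loop_classP/loop_cst_cat.
Qed.

Lemma pi1_mulg1 : right_id pi1_one pi1_mul.
Proof.
move=> u; rewrite -(loop_class_repr u) pi1_mulE.
exact/loop_classP/loop_cat_cst.
Qed.

Lemma pi1_mulVg : left_inverse pi1_one pi1_inv pi1_mul.
Proof.
move=> u; rewrite -(loop_class_repr u) pi1_invE pi1_mulE.
exact/loop_classP/loop_rev_cat.
Qed.

Lemma pi1_mulgV : right_inverse pi1_one pi1_inv pi1_mul.
Proof.
move=> u; rewrite -(loop_class_repr u) pi1_invE pi1_mulE.
exact/loop_classP/loop_cat_rev.
Qed.

HB.instance Definition _ := isGroup.Build fundamental_group pi1_mulA
  pi1_mul1g pi1_mulg1 pi1_mulVg pi1_mulgV.

End fundamental_group.

Definition sphere3 (R : realType) : set 'rV[R]_4 :=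
  [set v | \sum_(i < 4) v ord0 i ^+ 2 = 1].

Section closed_curves.
Context (R : realType) (V : topologicalType) (n : nat).
Implicit Type c : 'I_n -> R -> V.

(* Pairwise disjoint simple closed curves, each of them given by a 1-periodic
   map and oriented by increasing parameter. *)
Definition disjoint_simple_closed c : Prop :=
  [/\ forall i, continuous (c i),
      forall i t, c i (t + 1) = c i t &
      forall i s j t, c i s = c j t -> i = j /\ exists k : int, s = t + k%:~R].

Definition curve_support c : set V := \bigcup_i range (c i).

End closed_curves.

Record link (R : realType) : Type := Link {
  ncomp : nat;
  ncomp_gt0 : (0 < ncomp)%N;
  strand : 'I_ncomp -> R -> 'rV[R]_4;
  strand_closed : disjoint_simple_closed strand;
  strand_sphere : curve_support strand `<=` @sphere3 R
}.

Arguments strand {R} l i t.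

Definition link_complement (R : realType) (L : link R) : Type :=
  set_type (@sphere3 R `\` curve_support (strand L)).

HB.instance Definition _ (R : realType) (L : link R) :=
  Topological.on (link_complement L).

Definition link_group (R : realType) (L : link R) (p : link_complement L) :
  groupType := fundamental_group R p.

Section diagrams.
Context (R : realType).

(* The projection plane of a diagram is spanned by the first two coordinates
   of R^3; the third one is the height. *)
Definition plane (v : 'rV[R]_3) : 'rV[R]_2 := lsubmx (v : 'rV[R]_(2 + 1)).
Definition height (v : 'rV[R]_3) : R := v ord0 ord_max.

(* Inverse of the stereographic projection from the last basis vector. *)
Definition stereo (v : 'rV[R]_3) : 'rV[R]_4 :=
  let q := \sum_(i < 3) v ord0 i ^+ 2 in
  row_mx ((2 / (q + 1)) *: v) ((q - 1) / (q + 1))%:M.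

Context (n : nat) (c : 'I_n -> R -> 'rV[R]_3).

(* The strand [i] at time [s] passes over the strand [j] at time [t]. *)
Definition crossing (i : 'I_n) (s : R) (j : 'I_n) (t : R) : Prop :=
  plane (c i s) = plane (c j t) /\ height (c j t) < height (c i s).

(* Positive exactly when the over-strand followed by the under-strand is a
   direct basis of the plane seen from above, that is, at a positive crossing. *)
Definition crossing_det (i : 'I_n) (s : R) (j : 'I_n) (t : R) : R :=
  \det (col_mx (plane (derive1 (c i) s)) (plane (derive1 (c j) t)) : 'M[R]_2).

Definition under_points : set 'rV[R]_3 :=
  [set v | exists i s j t, crossing i s j t /\ v = c j t].

Record regular_projection : Prop := RegularProjection {
  rp_derivable : forall i t, derivable (c i) t 1;
  rp_continuous : forall i, continuous (derive1 (c i));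
  rp_immersion : forall i t, plane (derive1 (c i) t) != 0;
  rp_transverse : forall i s j t, crossing i s j t -> crossing_det i s j t != 0;
  rp_double : forall i s j t k u,
    plane (c i s) = plane (c j t) -> plane (c j t) = plane (c k u) ->
    [\/ c i s = c j t, c j t = c k u | c i s = c k u];
  rp_finite : finite_set under_points
}.

(* The arcs are the pieces into which the under-points cut the curves, here
   taken without their endpoints and in R^3 rather than in the plane. *)
Definition arcs : set (set 'rV[R]_3) :=
  connected_component (curve_support c `\` under_points) @`
    (curve_support c `\` under_points).

Definition arc : Type := set_type arcs.

Definition over_arc (i : 'I_n) (s : R) (y : arc) : Prop := val y (c i s).
Definition incoming_arc (j : 'I_n) (t : R) (x : arc) : Prop :=
  \forall u \near t^'-, val x (c j u).
Definition outgoing_arc (j : 'I_n) (t : R) (z : arc) : Prop :=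
  \forall u \near t^'+, val z (c j u).

Inductive wirtinger_rel : gterm arc -> gterm arc -> Prop :=
| wirtinger_pos i s j t x y z :
    crossing i s j t -> 0 < crossing_det i s j t ->
    over_arc i s y -> incoming_arc j t x -> outgoing_arc j t z ->
    wirtinger_rel (GVar z) (GMul (GMul (GVar y) (GVar x)) (GInv (GVar y)))
| wirtinger_neg i s j t x y z :
    crossing i s j t -> crossing_det i s j t < 0 ->
    over_arc i s y -> incoming_arc j t x -> outgoing_arc j t z ->
    wirtinger_rel (GVar z) (GMul (GMul (GInv (GVar y)) (GVar x)) (GVar y)).

End diagrams.

(* Each [H t] is a continuous bijection of the compact Hausdorff space S^3,
   hence a homeomorphism. *)
Definition ambient_isotopy (R : realType) (H : R -> 'rV[R]_4 -> 'rV[R]_4) :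
    Prop :=
  [/\ {within `[0, 1] `*` @sphere3 R,
        continuous (fun tv : R * 'rV[R]_4 => H tv.1 tv.2)},
      forall t, 0 <= t <= 1 ->
        set_bij (@sphere3 R) (@sphere3 R) (H t) &
      forall v, sphere3 v -> H 0 v = v].

Definition diagram_of (R : realType) (L : link R)
    (c : 'I_(ncomp L) -> R -> 'rV[R]_3) : Prop :=
  [/\ disjoint_simple_closed c, regular_projection c &
      exists2 H, ambient_isotopy H &
        forall i t, H 1 (strand L i t) = stereo (c i t)].

(* The generators are only required to realize the Wirtinger presentation of
   some diagram of [L]; no choice of meridian loops representing them is made. *)
Definition wirtinger_generating_set (R : realType) (L : link R)
    (p : link_complement L) (S : set (link_group p)) : Prop :=
  exists2 c : 'I_(ncomp L) -> R -> 'rV[R]_3, diagram_of c &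
  exists2 w : arc c -> link_group p,
    is_presentation (wirtinger_rel (c := c)) w & S = range w.

Lemma wirtinger_generating_set_neq0 (R : realType) (L : link R)
    (p : link_complement L) (S : set (link_group p)) :
  wirtinger_generating_set S -> S !=set0.
Proof.
move=> [c [[_ _ cinj] creg _] [w _ ->]].
suff [v Kv] : curve_support c `\` under_points c !=set0.
  have av : arcs c (connected_component (curve_support c `\` under_points c) v).
    by exists v.
  exists (w (SigSub (mem_set av))); exists (SigSub (mem_set av)) => //.
apply: contrapT => /set0P/negP; rewrite negbK => /eqP K0.
have supp_fin : finite_set (curve_support c).
  apply: sub_finite_set (rp_finite creg) => v cv.
  by apply: contrapT => uv; have : set0 v by rewrite -K0; split.
pose f (m : nat) : 'rV[R]_3 := c (Ordinal (ncomp_gt0 L)) (m.+1%:R^-1).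
have finj : {in [set: nat] &, injective f}.
  move=> a b _ _ /cinj [_ [k abk]].
  have bnd (m : nat) : 0 < (m.+1%:R^-1 : R) <= 1.
    by rewrite invr_gt0 ltr0Sn invf_le1 ?ltr0Sn// ler1n.
  have key (x y z : R) : x = y + z -> 0 < x <= 1 -> 0 < y <= 1 -> -1 < z < 1.
    by move=> -> /andP[? ?] /andP[? ?]; apply/andP; split; lra.
  have /andP[] := key _ _ _ abk (bnd a) (bnd b).
  rewrite -(rmorph1 intr) -rmorphN !ltr_int => k1 k2.
  have k0 : k = 0 by lia.
  move: abk; rewrite k0 addr0 => /invr_inj /eqP.
  by rewrite eqr_nat => /eqP [].
have ffin : finite_set (f @^-1` curve_support c).
  by apply: finite_preimage supp_fin => a b _ _; apply: finj; rewrite in_setT.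
apply: infinite_nat; apply: sub_finite_set ffin => m _.
by exists (Ordinal (ncomp_gt0 L)).
Qed.

(* Main.v *)
Require Import Defs.
From HB Require Import structures.
From mathcomp Require Import all_boot all_order all_algebra.
From mathcomp Require Import all_classical all_reals all_analysis.

(** Why the theorem holds.  Every Wirtinger relation says that one generator
is the conjugate of another by a third (or by its inverse), and this property
of the presentation is all that is used.  Let [G] be presented by a
family [w] with such relations, and let [D] be the Dehn quandle on the
conjugates of the [w x].

The inclusion of [D] in [G] turns the defining relations of [Env D] into
identities of [G], so it extends to a morphism from [Env D] to [G], sending
[e_a] to [a].  In the other direction, a conjugation relation between
generators of [G] is an equation between elements of [D], so it reappears
among the relations of [Env D]; hence [w x |-> e_(w x)] extends to a morphism
[psi] from [G] to [Env D].  The composite on [G] fixes each [w x], so it is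
the identity.  The other composite sends [e_a] to [psi a], and the point is
that [psi a = e_a] for every conjugate [a], not just for the generators.  This
follows from the equivariance [e_(g a g^-1) = psi g * e_a * (psi g)^-1]: for
[g = w x] it is a defining relation of [Env D], and the set of [g] for which
it holds is closed under products and inverses ([dehn_env_equivariant]). *)

Set Implicit Arguments.
Unset Strict Implicit.
Unset Printing Implicit Defensive.

Local Open Scope classical_set_scope.
Local Open Scope group_scope.

(** * Groups given by generators and relations *)

Lemma multiplicative1 (G H : groupType) (f : {multiplicative G -> H}) : f 1 = 1.
Proof. by apply: (@mulgI _ (f 1)); rewrite -gmulfM !mulg1. Qed.

Lemma multiplicativeV (G H : groupType) (f : {multiplicative G -> H}) (x : G) :
  f x^-1 = (f x)^-1.
Proof.
by apply: (@mulgI _ (f x)); rewrite -gmulfM !mulgV multiplicative1.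
Qed.

Fixpoint gterm_val (X : Type) (H : groupType) (v : X -> H) (t : gterm X) : H :=
  match t with
  | GVar x => v x
  | GOne => 1
  | GMul a b => gterm_val v a * gterm_val v b
  | GInv a => (gterm_val v a)^-1
  end.

Definition satisfies (X : Type) (rel : gterm X -> gterm X -> Prop)
    (H : groupType) (v : X -> H) : Prop :=
  forall a b, rel a b -> gterm_val v a = gterm_val v b.

Lemma gmulf_gterm_val (X : Type) (G H : groupType)
    (f : {multiplicative G -> H}) (v : X -> G) (t : gterm X) :
  f (gterm_val v t) = gterm_val (fun x => f (v x)) t.
Proof.
elim: t => [x||a IHa b IHb|a IHa] //=.
- exact: multiplicative1.
- by rewrite gmulfM IHa IHb.
- by rewrite multiplicativeV IHa.
Qed.

Section presented_group_theory.
Context (X : Type) (rel : gterm X -> gterm X -> Prop).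

Lemma gclass_gterm_val (t : gterm X) : gclass rel t = gterm_val (gen rel) t.
Proof.
elim: t => [x||a IHa b IHb|a IHa] //=.
- by rewrite -IHa -IHb; exact/esym/presented_mulE.
- by rewrite -IHa; exact/esym/presented_invE.
Qed.

Lemma gen_satisfies : satisfies rel (gen rel).
Proof.
by move=> a b ab; rewrite -!gclass_gterm_val; apply/gclassP/gterm_rel.
Qed.

Lemma gterm_eq_val (H : groupType) (v : X -> H) (a b : gterm X) :
  satisfies rel v -> gterm_eq rel a b -> gterm_val v a = gterm_val v b.
Proof.
move=> hv; elim=> {a b} //=.
- by move=> b a c _ -> _ ->.
- by move=> a a' b b' _ -> _ ->.
- by move=> a a' _ ->.
- by move=> a b c; rewrite mulgA.
- by move=> a; rewrite mul1g.
- by move=> a; rewrite mulg1.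
- by move=> a; rewrite mulVg.
- by move=> a; rewrite mulgV.
Qed.

(** Von Dyck's theorem. *)
Lemma presented_group_lift (H : groupType) (v : X -> H) :
  satisfies rel v ->
  exists f : {multiplicative presented_group rel -> H},
    forall x, f (gen rel x) = v x.
Proof.
move=> hv; pose f (u : presented_group rel) := gterm_val v (repr u).
have fE t : f (gclass rel t) = gterm_val v t.
  exact: gterm_eq_val hv (repr_gclass rel t).
have fM : {morph f : u u' / u * u'}.
  move=> u u'; rewrite -(gclass_repr u) -(gclass_repr u').
  by rewrite [LHS](congr1 f (presented_mulE _ _ _)) !fE.
pose fMax := isMultiplicative.Build _ _ f fM.
pose F : {multiplicative presented_group rel -> H} := HB.pack f fMax.
by exists F => x; exact: fE (GVar x).
Qed.

Context (G : groupType) (w : X -> G) (Gw : is_presentation rel w).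

Lemma presentation_satisfies : satisfies rel w.
Proof.
have [f _ fE] := Gw; move=> a b ab.
have wE : w = fun x => f (gen rel x) by apply/funext => x; rewrite fE.
by rewrite wE -!gmulf_gterm_val (gen_satisfies ab).
Qed.

Lemma presentation_surj (g : G) : exists t, gterm_val w t = g.
Proof.
have [f [f' fK f'K] fE] := Gw; exists (repr (f' g)).
have wE : w = fun x => f (gen rel x) by apply/funext => x; rewrite fE.
by rewrite wE -gmulf_gterm_val -gclass_gterm_val gclass_repr f'K.
Qed.

Lemma presentation_ext (H : groupType) (f f' : {multiplicative G -> H}) :
  (forall x, f (w x) = f' (w x)) -> f =1 f'.
Proof.
move=> ff' g; have [t <-] := presentation_surj g.
by rewrite !gmulf_gterm_val; congr gterm_val; apply/funext.
Qed.

Lemma presentation_lift (H : groupType) (v : X -> H) :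
  satisfies rel v ->
  exists f : {multiplicative G -> H}, forall x, f (w x) = v x.
Proof.
move=> hv; have [k kE] := presented_group_lift hv.
have [f [f' fK f'K] fE] := Gw.
have f'M : {morph f' : u u' / u * u'} by exact: can2_gmulfM fK f'K.
pose f'Max := isMultiplicative.Build _ _ f' f'M.
pose F' : {multiplicative G -> presented_group rel} := HB.pack f' f'Max.
exists (k \o F' : {multiplicative _ -> _}) => x /=.
by rewrite -kE -fE fK.
Qed.

End presented_group_theory.

Lemma gen_presentation (X : Type) (rel : gterm X -> gterm X -> Prop) :
  is_presentation rel (gen rel).
Proof. by exists (idfun : {multiplicative _ -> _}) => //; exists id. Qed.

(** * Enveloping groups of Dehn quandles *)

(** The two shapes of [b] are those of the Wirtinger relations at a positive
and at a negative crossing. *)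
Definition conjugation_relations (X : Type) (rel : gterm X -> gterm X -> Prop) :
    Prop :=
  forall a b, rel a b -> exists x y z, a = GVar z /\
    (b = GMul (GMul (GVar y) (GVar x)) (GInv (GVar y)) \/
     b = GMul (GMul (GInv (GVar y)) (GVar x)) (GVar y)).

Section dehn_env.
Context (G : groupType) (A : set G) (A0 : A !=set0).
Local Notation D := (dehn_quandle A0).
Local Notation e := (gen (@env_rel D)).

Lemma env_gen_dehn (x y z : D) :
  val z = val y * val x * (val y)^-1 -> e z = e y * e x * (e y)^-1.
Proof.
move=> zE; have -> : z = qop x y by apply: val_inj; rewrite zE.
by have := @gen_satisfies _ (@env_rel D) _ _
  (ex_intro _ x (ex_intro _ y (conj erefl erefl))).
Qed.

Lemma dehn_val_satisfies : satisfies (@env_rel D) (val : D -> G).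
Proof. by move=> _ _ [x [y [-> ->]]]. Qed.

Lemma conj_dehn (g : G) (x : D) : exists y : D, val y = g * val x * g^-1.
Proof.
by exists (SigSub (mem_set (conjugates_dehn g (set_mem (valP x))))).
Qed.

(** By induction on a word [t] representing the conjugating element.  For an
inverse, the induction hypothesis is applied to the conjugated element and
then solved for [e x]. *)
Lemma dehn_env_equivariant (X : Type) (w : X -> G)
    (psi : {multiplicative G -> Env D}) (d : X -> D)
    (dE : forall x, val (d x) = w x) (psiE : forall x, psi (w x) = e (d x))
    (t : gterm X) (x y : D) :
  val y = gterm_val w t * val x * (gterm_val w t)^-1 ->
  e y = psi (gterm_val w t) * e x * (psi (gterm_val w t))^-1.
Proof.
elim: t x y => [s||a IHa b IHb|a IHa] x y /=.
- by rewrite psiE -dE; exact: env_gen_dehn.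
- rewrite multiplicative1 !invg1 !mulg1 !mul1g => yx.
  by congr gen; exact: val_inj.
- have [z zE] := conj_dehn (gterm_val w b) x.
  rewrite gmulfM !invgM => yE.
  rewrite (IHa z y) ?(IHb x z zE) ?mulgA//.
  by rewrite [LHS]yE zE !mulgA.
- rewrite multiplicativeV => yE.
  rewrite (IHa y x); first by rewrite !mulgA mulVg mul1g mulgK.
  by rewrite [\val y]yE !mulgA mulgV mul1g mulgVK.
Qed.

End dehn_env.

Lemma env_dehn_isomorphic (X : Type) (rel : gterm X -> gterm X -> Prop)
    (G : groupType) (w : X -> G) (A0 : range w !=set0) :
  conjugation_relations rel -> is_presentation rel w ->
  isomorphic (Env (dehn_quandle A0)) G.
Proof.
move=> relJ Gw; set D := dehn_quandle A0.
pose e : D -> Env D := gen (@env_rel D).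
have wD s : conjugates (range w) (w s).
  by exists (w s); [exists s|exists 1; rewrite ?conjg1].
pose d s : D := SigSub (mem_set (wD s)).
have [phi phiE] := presented_group_lift (@dehn_val_satisfies _ _ A0).
have ed_rel : satisfies rel (fun s => e (d s)).
  move=> a b ab; have := presentation_satisfies Gw ab.
  have [x [y [z [-> bE]]]] := relJ _ _ ab.
  case: bE => -> /= wz; first exact: env_gen_dehn.
  (* A negative crossing is a positive one read backwards. *)
  have -> : e (d x) = e (d y) * e (d z) * (e (d y))^-1.
    by apply: env_gen_dehn; rewrite /= wz !mulgA mulgV mul1g mulgK.
  by rewrite !mulgA mulVg mul1g mulgVK.
have [psi psiE] := presentation_lift Gw ed_rel.
have psi_val (a : D) : psi (val a) = e a.
  have [_ [s _ <-] [g _ aE]] := set_mem (valP a).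
  have [t tE] := presentation_surj Gw g^-1.
  have -> : e a = psi g^-1 * e (d s) * (psi g^-1)^-1.
    rewrite -tE.
    apply: (@dehn_env_equivariant _ _ A0 _ w psi d (fun=> erefl) psiE t (d s)).
    by rewrite tE -[val a]aE conjgE invgK mulgA.
  by rewrite -[val a]aE conjgE !gmulfM multiplicativeV psiE invgK mulgA.
exists phi; exists psi => u.
- apply: (presentation_ext (gen_presentation (@env_rel D))
    (f := psi \o phi : {multiplicative _ -> _})
    (f' := idfun : {multiplicative _ -> _})) => a /=.
  by rewrite phiE psi_val.
- apply: (presentation_ext Gw
    (f := phi \o psi : {multiplicative _ -> _})
    (f' := idfun : {multiplicative _ -> _})) => s /=.
  by rewrite psiE phiE.
Qed.

(** * Links *)

Lemma wirtinger_conjugation_relations (R : realType) (n : nat)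
    (c : 'I_n -> R -> 'rV[R]_3) :
  conjugation_relations (wirtinger_rel (c := c)).
Proof.
move=> _ _ [i s j t x y z _ _ _ _ _|i s j t x y z _ _ _ _ _];
  exists x, y, z; split=> //; by [left|right].
Qed.

Theorem corollary3p16 (R : realType) (L : link R) (p : link_complement L)
    (S : set (link_group p)) (hS : wirtinger_generating_set S) :
  isomorphic (Env (dehn_quandle (wirtinger_generating_set_neq0 hS)))
             (link_group p).
Proof.
move: (wirtinger_generating_set_neq0 hS).
have [c _ [w Gw ->]] := hS => A0.
exact: env_dehn_isomorphic (@wirtinger_conjugation_relations _ _ c) Gw.
Qed.
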